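(* Let $G$ be a simple graph on $n$ nodes with algebraic connectivity $\lambda_2$. If $d$ denotes the diameter of $G$, then $$\lambda_{2} \ge \frac{4}{\left(d-2+\frac{4}{n}\right) n}.$$
   Context: The distance between two nodes of $G$ is the number of edges in a shortest path joining them, and is defined to be $\infty$ if there is no such path. The diameter $d$ of $G$ is the maximum distance between any pair of nodes of $G$. The Laplacian matrix of $G$ is $L(G)=D-A$, where $A$ is the adjacency matrix of $G$ and $D$ is the diagonal degree matrix with $D(i,i)=\sum_j A(i,j)$. The smallest eigenvalue of $L(G)$ is $0$, with the all-one vector as a corresponding eigenvector. The algebraic connectivity $\lambda_2$ of $G$ is the second smallest eigenvalue of $L(G)$ (eigenvalues counted with multiplicity).
   Formalization: The complete graph on 3 nodes is excluded, since there the inequality fails (n=3, d=1, λ₂=3, right side 4); n ≥ 2 is assumed so that λ₂ exists; for K_4, where the right side is 4/0, it is read as 0; for disconnected G (d = ∞) the bound is read as 0. *)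

(* Defs.v *)
From mathcomp Require Import all_boot all_order all_algebra.
From mathcomp Require Import polyrcf.

Set Implicit Arguments.
Unset Strict Implicit.
Unset Printing Implicit Defensive.

Import Order.TTheory GRing.Theory Num.Theory.
Local Open Scope ring_scope.

Record sgraph (n : nat) := SGraph {
  adj :> rel 'I_n;
  adj_sym : symmetric adj;
  adj_irr : irreflexive adj
}.

Definition complete (n : nat) (G : sgraph n) : Prop :=
  forall u v : 'I_n, u != v -> G u v.

Definition joined_by (n : nat) (G : sgraph n) (u v : 'I_n) (k : nat) : bool :=
  [exists p : k.-tuple 'I_n,
     [&& path G u p, last u p == v & uniq (u :: p)]].

(* [None] stands for the infinite distance. Searching the lengths k < n is
   enough, since a path visits at most n nodes. *)
Definition dist (n : nat) (G : sgraph n) (u v : 'I_n) : option nat :=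
  ohead [seq k <- iota 0 n | joined_by G u v k].

(* [None] stands for the infinite diameter (G disconnected). *)
Definition diameter (n : nat) (G : sgraph n) : option nat :=
  if [forall u, forall v, dist G u v != None]
  then Some (\max_(u < n) \max_(v < n) odflt 0%N (dist G u v))%N
  else None.

Definition adjacency_mx (R : rcfType) (n : nat) (G : sgraph n) : 'M[R]_n :=
  \matrix_(i, j) (G i j)%:R.

Definition degree_mx (R : rcfType) (n : nat) (G : sgraph n) : 'M[R]_n :=
  diag_mx (\row_i \sum_j adjacency_mx R G i j).

Definition laplacian (R : rcfType) (n : nat) (G : sgraph n) : 'M[R]_n :=
  degree_mx R G - adjacency_mx R G.

(* The eigenvalues of A lying in R, in nondecreasing order and repeated
   according to multiplicity: [rootsR] lists the distinct roots increasingly.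
   A symmetric A has n of them; see [eigenvalues_unique]. *)
Definition eigenvalues (R : rcfType) (n : nat) (A : 'M[R]_n) : seq R :=
  flatten [seq nseq (mup x (char_poly A)) x | x <- rootsR (char_poly A)].

(* The second smallest eigenvalue of the Laplacian; the default value 0 of the
   indexing is only reached when n < 2. *)
Definition algebraic_connectivity (R : rcfType) (n : nat) (G : sgraph n) : R :=
  (eigenvalues (laplacian R G))`_1.

Lemma eigenvalues_unique (R : rcfType) (n : nat) (A : 'M[R]_n) (s : seq R) :
  sorted <=%R s -> char_poly A = \prod_(x <- s) ('X - x%:P) ->
  eigenvalues A = s.
Proof.
move=> s_sorted charA; pose p := char_poly A.
have p0 : p != 0 by rewrite monic_neq0 // char_poly_monic.
have r_sorted : sorted <%R (rootsR p) by exact: sorted_roots.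
have r_uniq : uniq (rootsR p) by exact: lt_sorted_uniq.
have mem_r x : (x \in rootsR p) = (x \in s).
  have /roots_onP/(_ x) := roots_on_rootsR p0.
  by rewrite in_itv /= => <- //; rewrite /p charA root_prod_XsubC.
apply: (sorted_eq le_trans le_anti) => //.
  rewrite /eigenvalues -/p.
  elim: (rootsR p) r_sorted {r_uniq mem_r} => //= x r IHr.
  rewrite (path_sortedE lt_trans) => /andP[/allP lex /IHr {IHr}].
  set t := flatten _ => t_sorted.
  have let_ : all (>= x) t.
    apply/allP => y /flattenP[_ /mapP[z zr ->]].
    by rewrite mem_nseq => /andP[_ /eqP->]; exact/ltW/lex.
  elim: (mup x p) => //= m IHm.
  rewrite (path_sortedE le_trans) IHm andbT all_cat let_ andbT.
  by apply/allP => y; rewrite mem_nseq => /andP[_ /eqP->].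
apply/allP => x _ /=; rewrite /eigenvalues -/p count_flatten -map_comp.
apply/eqP; rewrite -(mu_prod_XsubC x s) -charA -/p sumnE big_map.
have [xs|xs] := boolP (x \in rootsR p); last first.
  rewrite big1_seq => [|y /= yr]; last first.
    rewrite count_nseq /=; case: eqP => [yx|_]; last by rewrite mul0n.
    by rewrite -yx yr in xs.
  by rewrite /p charA mu_prod_XsubC; apply/esym/count_memPn; rewrite -mem_r.
rewrite (bigD1_seq x) //= count_nseq /= eqxx mul1n big1 ?addn0 // => y yx.
by rewrite count_nseq /= (negPf yx) mul0n.
Qed.

(* Main.v *)
Require Import Defs.
From mathcomp Require Import all_boot all_order all_algebra.
From mathcomp Require Import polyrcf complex lra ring zify.

Import Order.TTheory GRing.Theory Num.Theory.
Local Open Scope ring_scope.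

Set Implicit Arguments.
Unset Strict Implicit.
Unset Printing Implicit Defensive.

(** Let l be the second eigenvalue of the Laplacian and x an eigenvector for l
    orthogonal to the constants, with maximum M > 0 at u and minimum - m < 0
    at v. If l >= 1 and d >= 2 there is nothing to prove, so let l < 1 and put
    c = 1 - l.

    The eigenvalue equation at u says that the differences M - x w, over the
    neighbours w of u, are nonnegative and add up to l * M; so every neighbour
    has x w >= c * M ([eigenfunction_max_neighbor]), and likewise every
    neighbour of v has x w <= - c * m. Clip x to the interval
    [- c * m, c * M] and call the result y. Then y is constant along the first
    and the last edge of a shortest path from u to v, so that y drops by
    c * (M + m) along at most d - 2 edges, and Cauchy-Schwarz
    ([path_energy]) gives
      c ^ 2 * (M + m) ^ 2 <= (d - 2) * E(y),
    where E is the Dirichlet energy. On the other hand clipping is monotone and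
    1-Lipschitz, hence E(y) <= E(x, y) = l * \sum x y, and comparing x y with
    an affine function of x, whose linear part sums to 0 ([mul_clip_le]), gives
      \sum x y <= n * c * M * m <= n * c * (M + m) ^ 2 / 4.
    Together, 4 * (1 - l) <= (d - 2) * n * l, which rearranges to the bound;
    this is [eigenfunction_gap]. Clipping is what replaces the d of the
    classical bound 4 / (d * n) by d - 2 + 4 / n.

    A graph of diameter d <= 1 is complete, so l = n, and the inequality is
    checked directly.

    What remains is the existence of x ([second_eigenvector]). It needs all
    n eigenvalues to be real, and a two-dimensional eigenspace when the
    smallest one is repeated; both follow from diagonalizing the Laplacian over
    the real closed field. *)

(** * Real symmetric matrices *)

Lemma realmx_complex (R : rcfType) m n (B : 'M[R[i]]_(m, n)) :
  B \is a mxOver Num.real ->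
  B = map_mx (real_complex R) (map_mx (@complex.Re R) B).
Proof.
move=> /mxOverP B_real; apply/matrixP => i j; rewrite !mxE.
by rewrite [LHS](esym (RRe_real (B_real i j))).
Qed.

(** The spectral theorem is available over R[i], where the eigenvalues of a
    hermitian matrix are real. Two real matrices similar over R[i] are similar
    over R, so the diagonalization descends. *)
Lemma symmetric_diagonalizable (R : rcfType) n (A : 'M[R]_n) : A^T = A ->
  exists2 Pd : 'M[R]_n * 'rV[R]_n,
    Pd.1 \in unitmx & Pd.1 *m A = diag_mx Pd.2 *m Pd.1.
Proof.
move=> A_sym; pose f := real_complex R; pose C := map_mx f A.
have C_real : C \is a mxOver Num.real.
  by apply/mxOverP => i j; rewrite mxE; apply/complex_realP; exists (A i j).
have C_herm : C \is hermsymmx.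
  apply: realsym_hermsym => //; apply/is_hermitianmxP.
  by rewrite expr0 scale1r map_mx_id // map_trmx A_sym.
have /orthomx_spectralP C_diag := hermitian_normalmx C_herm.
have d_real := hermitian_spectral_diag_real C_herm.
have diag_real : diag_mx (spectral_diag C) \is a mxOver Num.real.
  apply/mxOverP => i j; rewrite mxE; case: (i == j); last exact: real0.
  by rewrite mulr1n; apply/mxOverP.
have [] := @real_similar _ _ C (diag_mx (spectral_diag C)).
- exists (spectralmx C); first exact: spectral_unit.
  apply/simmxP; first exact: spectral_unit.
  by rewrite {2}C_diag !mulmxA mulmxV ?spectral_unit// mul1mx.
- exact: C_real.
- exact: diag_real.
move=> P /andP[P_real P_unit] /(simmxP P_unit).
rewrite (realmx_complex P_real) (realmx_complex d_real) -map_diag_mx -!map_mxM.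
move=> /map_mx_inj PA; eexists (_, _); last exact: PA.
by rewrite /= -(map_unitmx f) -realmx_complex.
Qed.

Lemma char_poly_diagonalized (R : rcfType) n (A P : 'M[R]_n) (d : 'rV[R]_n) :
  P \in unitmx -> P *m A = diag_mx d *m P ->
  char_poly A = \prod_(i < n) ('X - (d 0 i)%:P).
Proof.
move=> P_unit PA.
transitivity (char_poly (diag_mx d)); last first.
  rewrite char_poly_trig ?diag_mx_is_trig //.
  by apply: eq_bigr => i _; rewrite mxE eqxx mulr1n.
have PX : map_mx polyC P *m char_poly_mx A =
    char_poly_mx (diag_mx d) *m map_mx polyC P.
  by rewrite mulmxBr mulmxBl -!map_mxM PA scalar_mxC.
have detP : \det (map_mx polyC P) != 0.
  by rewrite det_map_mx polyC_eq0 -unitfE -unitmxE.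
by apply: (mulfI detP); rewrite /= [RHS]mulrC /char_poly -!det_mulmx PX.
Qed.

Lemma eigenvalues_diagonalized (R : rcfType) n (A P : 'M[R]_n) (d : 'rV[R]_n) :
  P \in unitmx -> P *m A = diag_mx d *m P ->
  eigenvalues A = sort <=%R [seq d 0 i | i <- enum 'I_n].
Proof.
move=> P_unit PA; apply: eigenvalues_unique; first exact/sort_sorted/le_total.
rewrite (char_poly_diagonalized P_unit PA).
by rewrite (perm_big _ (permEl (perm_sort _ _))) /= big_map big_enum.
Qed.

Lemma mem_eigenvalues (R : rcfType) n (A : 'M[R]_n) a :
  (a \in eigenvalues A) = eigenvalue A a.
Proof.
have p0 : char_poly A != 0 by rewrite monic_neq0 // char_poly_monic.
have /(_ a) := roots_on_rootsR p0; rewrite in_itv /= => mem_r.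
rewrite eigenvalue_root_char mem_r; apply/flattenP/idP.
  by case=> _ /mapP[x xr ->]; rewrite mem_nseq => /andP[_ /eqP->].
move=> ar; exists (nseq (mup a (char_poly A)) a).
  by apply/mapP; exists a.
by rewrite mem_nseq eqxx andbT mup_geq // expr1 -root_factor_theorem mem_r.
Qed.

(** If the two smallest eigenvalues differ, symmetry of A makes eigenvectors of
    the second one orthogonal to w. If they coincide, two independent
    eigenvectors for the common value have a combination orthogonal to w. *)
Lemma second_eigenvector (R : rcfType) n (A : 'M[R]_n) (w : 'rV[R]_n) :
  (1 < n)%N -> A^T = A -> w *m A = (eigenvalues A)`_0 *: w ->
  exists2 x : 'rV[R]_n,
    x != 0 & x *m w^T = 0 /\ x *m A = (eigenvalues A)`_1 *: x.
Proof.
move=> n_gt1 A_sym; set s := eigenvalues A => wA.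
have [[P d] /= P_unit PA] := symmetric_diagonalizable A_sym.
pose t := sort (relpre (d 0) <=%R) (enum 'I_n).
have t_size : size t = n by rewrite size_sort size_enum_ord.
have t_uniq : uniq t by rewrite sort_uniq enum_uniq.
have sE : s = map (d 0) t.
  by rewrite -sort_map; exact: eigenvalues_diagonalized PA.
(* t lists the indices by increasing diagonal entry, so i and j are distinct
   even if the two smallest eigenvalues coincide. *)
pose i := nth (Ordinal n_gt1) t 0; pose j := nth (Ordinal n_gt1) t 1.
have ij : i != j by rewrite nth_uniq ?t_size // ltnW.
have di : d 0 i = s`_0 by rewrite sE (nth_map (Ordinal n_gt1)) // t_size ltnW.
have dj : d 0 j = s`_1 by rewrite sE (nth_map (Ordinal n_gt1)) // t_size.
have row_eigen k : row k P *m A = d 0 k *: row k P.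
  by rewrite -row_mul PA row_mul row_diag_mx -scalemxAl -rowE.
have P_neq0 (c : 'rV[R]_n) : c != 0 -> c *m P != 0.
  by apply: contraNneq => /eqP; rewrite mulmx_free_eq0 ?row_free_unit.
have row_neq0 k : row k P != 0.
  rewrite rowE; apply: P_neq0; apply/eqP => /matrixP/(_ 0 k)/eqP.
  by rewrite !mxE !eqxx oner_eq0.
have [s01|s01] := eqVneq s`_0 s`_1; last first.
  exists (row j P) => //; split; last by rewrite row_eigen dj.
  have : row j P *m A *m w^T = row j P *m (w *m A)^T.
    by rewrite trmx_mul A_sym mulmxA.
  rewrite row_eigen wA dj linearZ /= -scalemxAl -scalemxAr => /eqP.
  rewrite -subr_eq0 -scalerBl scaler_eq0 subr_eq0 eq_sym (negPf s01) /=.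
  by move/eqP.
pose a k := (row k P *m w^T) 0 0.
have aE k : row k P *m w^T = (a k)%:M by exact: mx11_scalar.
have [ai0|ai0] := eqVneq (a i) 0.
  exists (row i P) => //; split; last by rewrite row_eigen di s01.
  by rewrite aE ai0 raddf0.
exists (a i *: row j P - a j *: row i P); last split.
- rewrite !rowE !scalemxAl -mulmxBl; apply: P_neq0.
  apply/eqP => /matrixP/(_ 0 j)/eqP; rewrite !mxE !eqxx.
  rewrite [j == i]eq_sym (negPf ij).
  by rewrite mulr0 subr0 mulr1 (negPf ai0).
- rewrite mulmxBl -!scalemxAl !aE !scale_scalar_mx -raddfB /= mulrC subrr.
  exact: raddf0.
- rewrite mulmxBl -!scalemxAl !row_eigen di dj s01 scalerBr !scalerA.
  by rewrite ![_ * s`_1]mulrC.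
Qed.

(** * The Dirichlet energy of a graph *)

Definition eigenfunction (R : rcfType) n (G : sgraph n) (l : R)
    (x : 'I_n -> R) :=
  forall u, \sum_v (G u v)%:R * (x u - x v) = l * x u.

(** The sum runs over ordered pairs, so every edge counts twice; this is the
    origin of the factors 2 below. *)
Definition dirichlet (R : rcfType) n (G : sgraph n) (x y : 'I_n -> R) : R :=
  \sum_u \sum_v (G u v)%:R * ((x u - x v) * (y u - y v)).

Lemma laplacian_sym (R : rcfType) n (G : sgraph n) :
  (laplacian R G)^T = laplacian R G.
Proof.
apply/matrixP => i j; rewrite !mxE adj_sym eq_sym.
by case: eqP => [->|].
Qed.

Lemma mul_laplacianE (R : rcfType) n (G : sgraph n) (x : 'rV[R]_n) u :
  (x *m laplacian R G) 0 u = \sum_v (G u v)%:R * (x 0 u - x 0 v).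
Proof.
rewrite mulmxBr mxE mul_mx_diag !mxE mulr_sumr -sumrN -big_split /=.
apply: eq_bigr => v _; rewrite !mxE adj_sym; ring.
Qed.

Lemma laplacian_eigenfunction (R : rcfType) n (G : sgraph n) l (x : 'rV[R]_n) :
  x *m laplacian R G = l *: x -> eigenfunction G l (x 0).
Proof. by move=> xL u; rewrite -mul_laplacianE xL mxE. Qed.

Lemma dirichlet_eigenfunction (R : rcfType) n (G : sgraph n) l
    (x y : 'I_n -> R) :
  eigenfunction G l x -> dirichlet G x y = 2 * (l * \sum_u x u * y u).
Proof.
move=> xl; have half : l * \sum_u x u * y u =
    \sum_u \sum_v (G u v)%:R * (x u - x v) * y u.
  rewrite mulr_sumr; apply: eq_bigr => u _.
  by rewrite -mulr_suml xl mulrA.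
rewrite mulr_natl mulr2n half [X in _ = _ + X]exchange_big /= -big_split /=.
apply: eq_bigr => u _; rewrite -big_split /=; apply: eq_bigr => v _.
by rewrite [G v u]adj_sym; ring.
Qed.

Lemma dirichlet_ge0 (R : rcfType) n (G : sgraph n) (x : 'I_n -> R) :
  0 <= dirichlet G x x.
Proof.
apply: sumr_ge0 => u _; apply: sumr_ge0 => v _.
by apply: mulr_ge0; [exact: ler0n | rewrite -expr2 sqr_ge0].
Qed.

Lemma eigenvalue_laplacian_ge0 (R : rcfType) n (G : sgraph n) (l : R) :
  eigenvalue (laplacian R G) l -> 0 <= l.
Proof.
move=> /eigenvalueP[x /laplacian_eigenfunction/dirichlet_eigenfunction xl x0].
have := dirichlet_ge0 G (x 0); rewrite xl pmulr_rge0 // pmulr_lge0 //.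
have [i xi] : exists i, x 0 i != 0 by apply/rV0Pn.
rewrite (bigD1 i) //= ltr_pwDl //; first by rewrite -expr2 exprn_even_gt0.
by apply: sumr_ge0 => j _; rewrite -expr2 sqr_ge0.
Qed.

Lemma cauchy_schwarz_step (R : rcfType) (k a b e : R) :
  0 <= k -> 0 <= e -> 2 * b ^+ 2 <= k * e ->
  2 * (a + b) ^+ 2 <= (k + 1) * (2 * a ^+ 2 + e).
Proof.
move=> k_ge0 e_ge0 be; have [k0|k0] := eqVneq k 0.
  have /eqP-> : b == 0.
    have := sqr_ge0 b; rewrite -sqrf_eq0 => b2; apply/eqP; nra.
  nra.
(* Multiplied by k, the difference is at least 2 * (k * a - b) ^ 2. *)
rewrite -subr_ge0 -(@pmulr_rge0 _ k) ?lt0r ?k0 //.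
have := sqr_ge0 (k * a - b); nra.
Qed.

(** Cauchy-Schwarz along a path: the edges of a path without repeated nodes are
    distinct, so their energies add up to at most the total energy. *)
Lemma path_energy (R : rcfType) n (G : sgraph n) (y : 'I_n -> R) u p :
  path G u p -> uniq (u :: p) ->
  2 * (y u - y (last u p)) ^+ 2 <= (size p)%:R * dirichlet G y y.
Proof.
pose f a b : R := (G a b)%:R * ((y a - y b) * (y a - y b)).
have f_ge0 a b : 0 <= f a b.
  by apply: mulr_ge0; [exact: ler0n | rewrite -expr2 sqr_ge0].
have f_sym a b : f a b = f b a by rewrite /f adj_sym; ring.
move=> Gp p_uniq; pose E s := \sum_(a <- s) \sum_(b <- s) f a b.
have E_ge0 s : 0 <= E s by do 2!(apply: sumr_ge0 => ? _).
have E_cons a s : E (a :: s) = 2 * \sum_(b <- s) f a b + E s.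
  rewrite /E !big_cons.
  rewrite [X in _ + X = _](eq_bigr (fun c => f a c + \sum_(b <- s) f c b)).
    by rewrite big_split /= {1}/f subrr; ring.
  by move=> c _; rewrite big_cons f_sym.
apply: (@le_trans _ _ ((size p)%:R * E (u :: p))); last first.
  apply: ler_wpM2l => //; rewrite /E /dirichlet big_uniq //=.
  rewrite [leRHS](bigID (mem (u :: p))) /=; apply: ler_wpDr.
    by do 2!(apply: sumr_ge0 => ? _); exact: f_ge0.
  apply: ler_sum => a _; rewrite big_uniq //= [leRHS](bigID (mem (u :: p))) /=.
  by apply: ler_wpDr => //; apply: sumr_ge0 => ? _; exact: f_ge0.
(* Restricted to the nodes of the path, the energy obeys a recursion on lists,
   and adding a node adds at least the energy of its first edge. *)
elim: p u Gp {p_uniq} => [|w p IHp] u /=; first by rewrite subrr; nra.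
move=> /andP[uw /IHp {}IHp]; rewrite E_cons -[(size p).+1%:R]natr1.
have -> : y u - y (last w p) = (y u - y w) + (y w - y (last w p)) by ring.
apply: le_trans (cauchy_schwarz_step (y u - y w) (ler0n _ _) (E_ge0 _) IHp) _.
apply: ler_wpM2l; first by rewrite natr1.
rewrite lerD2r ler_pM2l // big_cons /f uw mul1r -expr2 lerDl.
by apply: sumr_ge0 => ? _; exact: f_ge0.
Qed.

(** The terms of the eigenvalue equation at a maximum are nonnegative, so each
    of them is at most the total l * x u. *)
Lemma eigenfunction_max_neighbor (R : rcfType) n (G : sgraph n) l
    (x : 'I_n -> R) u w :
  eigenfunction G l x -> (forall v, x v <= x u) -> G u w ->
  (1 - l) * x u <= x w.
Proof.
move=> xl x_le uw; have := xl u; rewrite (bigD1 w) //= uw mul1r.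
have : 0 <= \sum_(v | v != w) (G u v)%:R * (x u - x v).
  by apply: sumr_ge0 => v _; rewrite mulr_ge0 // subr_ge0.
lra.
Qed.

Lemma eigenfunctionN (R : rcfType) n (G : sgraph n) l (x : 'I_n -> R) :
  eigenfunction G l x -> eigenfunction G l (fun u => - x u).
Proof.
by move=> xl u; rewrite mulrN -xl -sumrN; apply: eq_bigr => v _; ring.
Qed.

(** * Clipping *)

Definition clip (R : rcfType) (a b z : R) := Num.max a (Num.min b z).

Lemma clip_contract (R : rcfType) (a b s t : R) : a <= b ->
  (clip a b s - clip a b t) * (clip a b s - clip a b t) <=
  (s - t) * (clip a b s - clip a b t).
Proof.
move=> ab; have incr p q : p <= q -> 0 <= clip a b q - clip a b p <= q - p.
  move=> pq; rewrite /clip /Num.max /Num.min; apply/andP.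
  by split; case: (ltP b p) => ?; case: (ltP b q) => ?;
    do ![case: ltP => ?]; lra.
by case: (leP s t) => [|/ltW] /incr/andP[]; nra.
Qed.

(** The right-hand side is the affine function of z equal to z * clip z at both
    ends z = - m and z = M when c <= 1. Its linear part disappears on summing
    over a function of mean 0; the case c = 1 is the Bhatia-Davis bound M * m on
    the variance. *)
Lemma mul_clip_le (R : rcfType) (c M m z : R) : 0 <= c -> - m <= z <= M ->
  0 <= M -> 0 <= m ->
  z * clip (- (c * m)) (c * M) z <= c * (M * m + (M - m) * z).
Proof.
move=> c0 /andP[mz zM] M0 m0; have [z0|z0] := leP 0 z.
  have le : clip (- (c * m)) (c * M) z <= c * M.
    rewrite /clip ge_max ge_min lexx /= andbT.
    by have := mulr_ge0 c0 M0; have := mulr_ge0 c0 m0; lra.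
  apply: le_trans (ler_wpM2l z0 le) _.
  rewrite -subr_ge0.
  have -> : c * (M * m + (M - m) * z) - z * (c * M) = c * (m * (M - z)) by ring.
  by rewrite !mulr_ge0 // subr_ge0.
have le : - (c * m) <= clip (- (c * m)) (c * M) z by rewrite /clip le_max lexx.
apply: le_trans (ler_wnM2l (ltW z0) le) _; rewrite -subr_ge0.
have -> : c * (M * m + (M - m) * z) - z * - (c * m) = c * (M * (m + z)) by ring.
by rewrite !mulr_ge0 //; lra.
Qed.

(** * The eigenvalue estimate *)

Lemma sum0_max_gt0 (R : rcfType) n (x : 'I_n -> R) u i :
  \sum_v x v = 0 -> x i != 0 -> (forall v, x v <= x u) -> 0 < x u.
Proof.
move=> x_sum xi x_le; rewrite ltNge; apply: contra xi => xu.
have x_npos v : 0 <= - x v by rewrite oppr_ge0; exact: le_trans (x_le v) xu.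
have /eqP := x_sum; rewrite -oppr_eq0 -sumrN psumr_eq0 // => /allP/(_ i).
by rewrite mem_index_enum /= oppr_eq0 => ->.
Qed.

(** The heart of the proof. The paths from u to v supplied by the hypothesis
    have length at most d. Since x is still positive at the neighbours of u and
    already negative at those of v, such a path has a first edge and a different
    last edge, and both can be removed without losing any of the drop of y. *)
Lemma eigenfunction_gap (R : rcfType) n (G : sgraph n) d (l : R)
    (x : 'I_n -> R) i :
  (forall u v, exists p,
     [/\ path G u p, last u p = v, uniq (u :: p) & (size p <= d)%N]) ->
  eigenfunction G l x -> \sum_u x u = 0 -> x i != 0 -> 0 <= l < 1 ->
  4 * (1 - l) <= (d%:R - 2) * (l * n%:R).
Proof.
move=> G_path xl x_sum xi /andP[l_ge0 l_lt1].
pose u := [arg max_(a > i) x a]%O; pose v := [arg min_(a < i) x a]%O.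
have x_max a : x a <= x u.
  by rewrite /u; case: arg_maxP => // b _; apply.
have x_min a : x v <= x a.
  by rewrite /v; case: arg_minP => // b _; apply.
pose M := x u; pose m := - x v; pose c := 1 - l.
pose y a := clip (- (c * m)) (c * M) (x a).
have c_gt0 : 0 < c by rewrite subr_gt0.
have M_gt0 : 0 < M := sum0_max_gt0 x_sum xi x_max.
have m_gt0 : 0 < m.
  apply: (@sum0_max_gt0 _ _ (fun a => - x a) _ i).
  - by rewrite sumrN x_sum oppr0.
  - by rewrite oppr_eq0.
  - by move=> a; rewrite lerN2.
have cM_gt0 := mulr_gt0 c_gt0 M_gt0; have cm_gt0 := mulr_gt0 c_gt0 m_gt0.
have nbr_u w : G u w -> c * M <= x w by exact: eigenfunction_max_neighbor.
have nbr_v w : G v w -> x w <= - (c * m).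
  move=> vw; rewrite lerNr.
  apply: (eigenfunction_max_neighbor (eigenfunctionN xl) _ vw) => a.
  by rewrite lerN2.
have [[|w p] [/= uw pv p_uniq p_size]] := G_path u v.
  by move: M_gt0 m_gt0; rewrite /M /m pv; lra.
case/lastP: p uw pv p_uniq p_size => [|q z].
  by rewrite /= andbT => /nbr_u xw wv; move: m_gt0; rewrite /m -wv; lra.
rewrite rcons_path last_rcons size_rcons => /and3P[/nbr_u xw wq qz] zv.
rewrite {}zv adj_sym in qz * => /= /and3P[_ w_q].
rewrite rcons_uniq => /andP[_ q_uniq] q_size.
have {}w_q : w \notin q by move: w_q; rewrite mem_rcons inE negb_or => /andP[].
have yw : y w = c * M.
  by rewrite /y /clip (min_idPl xw) (max_idPr _) //; lra.
have yq : y (last w q) = - (c * m).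
  have xq := nbr_v _ qz; rewrite /y /clip (min_idPr _) ?(max_idPl _) //; lra.
(* u :: w :: ... has been stripped of its first and last edge, where y is
   constant; q lists the nodes after w and before v. *)
have := path_energy y wq; rewrite /= w_q q_uniq yw yq opprK.
move=> /(_ isT).
set D := dirichlet _ _ _ => D_path.
have D_ge0 : 0 <= D := dirichlet_ge0 G y.
have D_le : D <= 2 * (l * (c * (M * m) *+ n)).
  apply: (@le_trans _ _ (dirichlet G x y)).
    apply: ler_sum => a _; apply: ler_sum => b _; apply: ler_wpM2l => //.
    by apply: clip_contract; lra.
  rewrite (dirichlet_eigenfunction _ xl) ler_pM2l // ler_wpM2l //.
  apply: (@le_trans _ _ (\sum_a c * (M * m + (M - m) * x a))).
    apply: ler_sum => a _; apply: mul_clip_le; [exact: ltW | | exact: ltW..].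
    by rewrite /m opprK x_min x_max.
  rewrite -mulr_sumr big_split /= -[X in _ + X]mulr_sumr x_sum.
  by rewrite mulr0 addr0 sumr_const card_ord mulrnAr.
have size_le : (size q)%:R <= d%:R - 2 :> R.
  by rewrite lerBrDr -natrD ler_nat addn2.
have d2_ge0 : 0 <= d%:R - 2 :> R by exact: le_trans size_le.
have D_path1 := le_trans D_path (ler_wpM2r D_ge0 size_le).
have D_path2 := le_trans D_path1 (ler_wpM2l d2_ge0 D_le).
have S_gt0 : 0 < 2 * c * (M + m) ^+ 2.
  by apply: mulr_gt0; [exact: mulr_gt0 | apply/exprn_gt0/addr_gt0].
(* AM-GM in the form 4 * M * m <= (M + m) ^ 2; the difference of the two sides
   is a multiple of (M - m) ^ 2. *)
rewrite -(ler_pM2l S_gt0).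
apply: (@le_trans _ _ (4 * ((d%:R - 2) * (2 * (l * (c * (M * m) *+ n)))))).
  by apply: le_trans (ler_wpM2l _ D_path2) => //; rewrite /c; nra.
rewrite -[c * (M * m) *+ n]mulr_natr -subr_ge0.
set k := d%:R - 2.
have -> : 2 * c * (M + m) ^+ 2 * (k * (l * n%:R)) -
   4 * (k * (2 * (l * (c * (M * m) * n%:R)))) =
  2 * c * (k * (l * n%:R)) * (M - m) ^+ 2 by ring.
have c_ge0 := ltW c_gt0; apply: mulr_ge0; last exact: sqr_ge0.
by do ?[apply: mulr_ge0].
Qed.

(** * Diameter and algebraic connectivity *)

Lemma complete_eigenfunction (R : rcfType) n (G : sgraph n) (l : R)
    (x : 'I_n -> R) i :
  complete G -> eigenfunction G l x -> \sum_u x u = 0 -> x i != 0 -> l = n%:R.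
Proof.
move=> G_complete xl x_sum xi; apply: (mulIf xi); rewrite -xl.
transitivity (\sum_v (x i - x v)).
  apply: eq_bigr => v _; have [->|iv] := eqVneq i v.
    by rewrite subrr mulr0.
  by rewrite G_complete // mul1r.
by rewrite sumrB x_sum subr0 sumr_const card_ord mulr_natl.
Qed.

Lemma diameter_path n (G : sgraph n) d u v : diameter G = Some d ->
  exists p, [/\ path G u p, last u p = v, uniq (u :: p) & (size p <= d)%N].
Proof.
rewrite /diameter; case: ifP => // /forallP/(_ u)/forallP/(_ v) uv [<-].
case E : (dist G u v) uv => [k|] // _.
have k_le : (k <= \max_(a < n) \max_(b < n) odflt 0 (dist G a b))%N.
  apply: leq_trans (leq_bigmax u); apply: leq_trans (leq_bigmax v).
  by rewrite E.
have : k \in [seq k <- iota 0 n | joined_by G u v k].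
  by move: E; rewrite /dist; case: filter => //= a s [->]; rewrite mem_head.
rewrite mem_filter => /andP[/existsP[p /and3P[Gp /eqP pv p_uniq]] _].
by exists p; rewrite size_tuple.
Qed.

Lemma algebraic_connectivity_ge0 (R : rcfType) n (G : sgraph n) :
  0 <= algebraic_connectivity R G.
Proof.
rewrite /algebraic_connectivity; set s := eigenvalues _.
have [s_gt1|?] := ltnP 1 (size s); last by rewrite nth_default.
by apply: (@eigenvalue_laplacian_ge0 _ _ G); rewrite -mem_eigenvalues mem_nth.
Qed.

(** The constants are an eigenvector for 0, which is the smallest eigenvalue as
    the Laplacian is positive semidefinite; so the second eigenvector can be
    taken orthogonal to the constants. *)
Lemma algebraic_connectivity_eigenfunction (R : rcfType) n (G : sgraph n) :
  (1 < n)%N -> exists x : 'I_n -> R, exists i,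
    [/\ x i != 0, \sum_u x u = 0
      & eigenfunction G (algebraic_connectivity R G) x].
Proof.
move=> n_gt1; pose w : 'rV[R]_n := const_mx 1; pose L := laplacian R G.
have L_sym : L^T = L := laplacian_sym R G.
have wL : w *m L = 0.
  apply/rowP => u; rewrite mul_laplacianE [RHS]mxE big1 // => v _.
  by rewrite !mxE subrr mulr0.
have w0 : w != 0.
  by apply/rV0Pn; exists (Ordinal n_gt1); rewrite mxE oner_eq0.
have s0 : (eigenvalues L)`_0 = 0.
  have : 0 \in eigenvalues L.
    by rewrite mem_eigenvalues; apply/eigenvalueP; exists w; rewrite // scale0r.
  have : all (fun a => 0 <= a) (eigenvalues L).
    apply/allP => a; rewrite mem_eigenvalues.
    exact: eigenvalue_laplacian_ge0.
  have [[P d] /= P_unit PA] := symmetric_diagonalizable L_sym.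
  have : sorted <=%R (eigenvalues L).
    by rewrite (eigenvalues_diagonalized P_unit PA); exact/sort_sorted/le_total.
  case: eigenvalues => //= a s; rewrite (path_sortedE le_trans).
  move=> /andP[/allP le_a _].
  move=> /andP[a_ge0 _]; rewrite inE => /predU1P[//|/le_a a_le0].
  by apply/eqP; rewrite eq_le a_le0.
have [|x /rV0Pn[i xi] [xw xL]] := @second_eigenvector _ _ L w n_gt1 L_sym.
  by rewrite wL s0 scale0r.
exists (x 0), i; split=> //.
  have /matrixP/(_ 0 0) := xw; rewrite !mxE => {2}<-.
  by apply: eq_bigr => u _; rewrite !mxE mulr1.
exact: laplacian_eigenfunction xL.
Qed.

(* The triangle is excluded because it violates the bound: it has n = 3, d = 1
   and second eigenvalue 3, while 4 / ((1 - 2 + 4/3) * 3) = 4. *)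
Theorem mainTheorem2 (R : rcfType) (n : nat) (G : sgraph n)
    (n_ge2 : (2 <= n)%N) (G_not_triangle : ~ (n = 3%N /\ complete G)) :
  match diameter G with
  | Some d =>
      4 / ((d%:R - 2 + 4 / n%:R) * n%:R) <= algebraic_connectivity R G
  | None => (* d is infinite and the bound is 0 *)
      0 <= algebraic_connectivity R G
  end.
Proof.
have l_ge0 := algebraic_connectivity_ge0 R G.
case d_def : (diameter G) => [d|] //.
have G_path u v := diameter_path u v d_def.
have [x [i [xi x_sum xl]]] := algebraic_connectivity_eigenfunction R G n_ge2.
set l := algebraic_connectivity R G in l_ge0 xl *.
have n0 : n%:R != 0 :> R by rewrite pnatr_eq0 -lt0n ltnW.
rewrite [(_ + 4 / _) * _]mulrDl divfK //.
have [d_ge2|d_lt2] := leqP 2 d.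
  have d2_ge0 : 0 <= (d%:R - 2) * n%:R :> R.
    by rewrite mulr_ge0 // subr_ge0 ler_nat.
  rewrite ler_pdivrMr ?ltr_wpDl //.
  have [l_ge1|l_lt1] := leP 1 l; first by nra.
  have l_range : 0 <= l < 1 by rewrite l_ge0.
  by have := eigenfunction_gap G_path xl x_sum xi l_range; lra.
have G_complete : complete G.
  move=> u v uv; have [p [Gp pv _ p_size]] := G_path u v.
  case: p Gp pv p_size => [_ /= uv0|w [|? ?]] /=.
  - by rewrite uv0 eqxx in uv.
  - by rewrite andbT => uw <-.
  - by move=> _ _ /leq_trans/(_ (_ : (d <= 1)%N)) => /(_ d_lt2).
have -> : l = n%:R := complete_eigenfunction G_complete xl x_sum xi.
(* For n >= 4 the denominator is at most 0, hence so is the bound. The case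
   n = 3 is the triangle, and n = 2 is checked by hand, where d = 0 would give
   the value 4 / 0 = 0. *)
have [n_ge4|n_lt4] := leqP 4 n.
  apply: (@le_trans _ _ 0); last exact: ler0n.
  rewrite pmulr_rle0 // invr_le0.
  have d_le1 : d%:R <= 1 :> R by rewrite (ler_nat _ d 1).
  have n_ge4R : 4 <= n%:R :> R by rewrite ler_nat.
  by nra.
have n2 : n = 2%N.
  have n3 : n <> 3 by move=> n3; apply: G_not_triangle.
  lia.
rewrite n2; case: d d_lt2 {d_def G_path} => [|[|//]] _.
  by rewrite (_ : (0%:R - 2) * 2 + 4 = 0 :> R) ?invr0 ?mulr0 ?ler0n //; ring.
by rewrite (_ : (1 - 2) * 2 + 4 = 2 :> R); [lra | ring].
Qed.
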